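(* Let $\mu\in\mathbb N_0$, let $W\in\mathsf{Gr}_\mu(F)$ and let $A\subseteq F$ be a subalgebra (for the polynomial multiplication of $F=\mathbb C[\partial_1,\dots,\partial_n]$) with $W\cdot A=W$. Let $S$ be a Sato operator of $W$. Then: (1) for every $f\in A$ there is a unique $\mathtt L_S(f)\in\mathfrak S$ with $S\cdot f=\mathtt L_S(f)\cdot S$ in $\mathfrak S$, and $o(\mathtt L_S(f))=\deg(f)$; (2) $A\to\mathfrak S$, $f\mapsto\mathtt L_S(f)$, is an injective homomorphism of $\mathbb C$-algebras; (3) for every $f\in A$ and $w\in F$: $(w\circ\mathtt L_S(f))\circ S=(w\circ S)\cdot f$, i.e. the map $F\to W$, $w\mapsto w\circ S$, intertwines the right action of $\mathtt L_S(f)$ on $F$ with multiplication by $f$ on $W$.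
   Context: $n\in\mathbb N$, $\widehat B=\mathbb C[[x_1,\dots,x_n]]$, $\mathfrak m$ its maximal ideal, $\upsilon$ the $\mathfrak m$-adic valuation. $\mathfrak S$ is the algebra of formal sums $P=\sum_{\underline k\in\mathbb N_0^n}a_{\underline k}\underline\partial^{\underline k}$ ($a_{\underline k}\in\widehat B$) of finite order $o(P)=\sup_{\underline k}(|\underline k|-\upsilon(a_{\underline k}))$, with multiplication given by the Leibniz rule; it contains $\mathbb C[\partial_1,\dots,\partial_n]$. Writing $P=\sum\alpha_{\underline k,\underline i}\underline x^{\underline i}\underline\partial^{\underline k}$, the homogeneous components are $P_m=\sum_{|\underline i|-|\underline k|=m}\alpha_{\underline k,\underline i}\underline x^{\underline i}\underline\partial^{\underline k}$ and the symbol is $\sigma(P)=P_{-o(P)}$. $F=\mathfrak S/\mathfrak m\mathfrak S\cong\mathbb C[\partial_1,\dots,\partial_n]$ is a right $\mathfrak S$-module ($w\circ P$); the order of $w\in F$ is its degree. $P$ is regular if $w\mapsto w\circ\sigma(P)$ is injective on $F$. For $W\subseteq F$, $W_k=\{w\in W:o(w)\le k\}$; $\mathsf{Gr}_\mu(F)=\{W:\dim W_{\mu+k}=\binom{n+k}{n}\ \forall k\in\mathbb N_0\}$. A Sato operator of $W$ is a regular $S\in\mathfrak S$ with $o(S)=\mu$ and $W=F\circ S$. *)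

(* Defs.v *)
From HB Require Import structures.
From mathcomp Require Import all_boot all_algebra.
From mathcomp Require Import Rstruct.
From mathcomp Require Import complex.
From mathcomp Require Import mpoly.
From Stdlib Require Rdefinitions ClassicalEpsilon.

Set Implicit Arguments.
Unset Strict Implicit.
Unset Printing Implicit Defensive.

Import GRing.Theory.
Local Open Scope ring_scope.

Definition C : numClosedFieldType := (Rdefinitions.R)[i].

(* F = C[d_1,...,d_n] is represented by {mpoly C[n]}, the variable 'X_i
   standing for d_i.  Multi-indices are monomials 'X_{1..n}. *)

(* An element of \mathfrak S is given by its coefficient family:
   P k i = coefficient alpha_{k,i} of  x^i d^k  (k: d-exponent, i: x-exponent),
   i.e. P = sum_k a_k d^k with a_k = sum_i (P k i) x^i in C[[x]]. *)
Definition sop (n : nat) := 'X_{1..n} -> 'X_{1..n} -> C.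

(* |k| - v(a_k) <= b for all k  <=>  every nonzero coefficient satisfies
   |k| <= |i| + b. *)
Definition has_bound n (P : sop n) (b : nat) :=
  forall k i, P k i != 0 -> (mdeg k <= mdeg i + b)%N.

Definition inS n (P : sop n) := exists b : nat, has_bound P b.

Definition bnd n (P : sop n) : nat :=
  match ClassicalEpsilon.excluded_middle_informative (inS P) with
  | left H => proj1_sig (ClassicalEpsilon.constructive_indefinite_description _ H)
  | right _ => 0%N
  end.

(* Leibniz coefficient for  d^(j+d) . x^q  -> x^(q-j) d^d :
   prod_t binom(j_t+d_t, j_t) * q_t (q_t-1) ... (q_t-j_t+1) *)
Definition leib n (j d q : 'X_{1..n}) : nat :=
  (\prod_(t < n) ('C(j t + d t, j t) * (q t) ^_ (j t)))%N.

(* Product in \mathfrak S given by the Leibniz rule: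
   (x^p d^k)(x^q d^l) = sum_j binom(k,j) (d^j x^q) x^p d^(k-j+l).
   Coefficient of x^i d^m: sum over j, d <= m, p <= i with k = j + d,
   l = m - d, q = i - p + j.  For P of finite order only finitely many j
   contribute (|j| <= |i| + bnd P), so the sum below is the full sum. *)
Definition mulS n (P Q : sop n) : sop n := fun m i =>
  \sum_(j : 'X_{1..n < (mdeg i + bnd P).+1})
   \sum_(d : 'X_{1..n < (mdeg m).+1} | (val d <= m)%MM)
    \sum_(p : 'X_{1..n < (mdeg i).+1} | (val p <= i)%MM)
      P (val j + val d)%MM (val p) * Q (m - val d)%MM (i - val p + val j)%MM
        * (leib (val j) (val d) (i - val p + val j)%MM)%:R.

Definition addS n (P Q : sop n) : sop n := fun k i => P k i + Q k i.
Definition scaleS n (a : C) (P : sop n) : sop n := fun k i => a * P k i.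
Definition oneS n : sop n := fun k i => ((k == 0%MM) && (i == 0%MM))%:R.

Definition emb n (f : {mpoly C[n]}) : sop n :=
  fun k i => if i == 0%MM then f@_k else 0.

(* The right S-module structure on F = S / mS:  w o P  is the class of the
   product w.P modulo mS, identified with the polynomial formed by the
   x^0-coefficients of w.P.  Only monomials of total degree
   < msize w + bnd P can occur. *)
Definition actF n (w : {mpoly C[n]}) (P : sop n) : {mpoly C[n]} :=
  \sum_(m : 'X_{1..n < (msize w + bnd P).+1})
     (mulS (emb w) P (val m) 0%MM) *: 'X_[val m].

Definition is_order n (P : sop n) (o : option int) : Prop :=
  match o with
  | None => forall k i, P k i = 0
  | Some d =>
      (exists k i, P k i != 0 /\ (mdeg k)%:Z - (mdeg i)%:Z = d) /\
      (forall k i, P k i != 0 -> (mdeg k)%:Z - (mdeg i)%:Z <= d)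
  end.

Definition degF n (f : {mpoly C[n]}) : option int :=
  if f == 0 then None else Some ((msize f).-1)%:Z.

Definition hcomp n (P : sop n) (m : int) : sop n :=
  fun k i => if (mdeg i)%:Z - (mdeg k)%:Z == m then P k i else 0.

Definition regular n (P : sop n) : Prop :=
  exists d : int, is_order P (Some d) /\
    injective (fun w : {mpoly C[n]} => actF w (hcomp P (- d))).

Definition Sato n (mu : nat) (W : {mpoly C[n]} -> Prop) (S : sop n) : Prop :=
  [/\ inS S, regular S, is_order S (Some mu%:Z)
    & forall u, W u <-> exists w, u = actF w S].

Definition subspace n (W : {mpoly C[n]} -> Prop) : Prop :=
  W 0 /\ forall (a : C) u v, W u -> W v -> W (a *: u + v).

Definition Wk n (W : {mpoly C[n]} -> Prop) (k : nat) : {mpoly C[n]} -> Prop :=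
  fun w => W w /\ (msize w <= k.+1)%N.

Definition has_dim n (U : {mpoly C[n]} -> Prop) (d : nat) : Prop :=
  exists b : 'I_d -> {mpoly C[n]},
    [/\ forall t, U (b t),
        forall c : 'I_d -> C, \sum_(t < d) c t *: b t = 0 -> forall t, c t = 0
      & forall u, U u -> exists c : 'I_d -> C, u = \sum_(t < d) c t *: b t].

Definition Gr n (mu : nat) (W : {mpoly C[n]} -> Prop) : Prop :=
  subspace W /\ forall k : nat, has_dim (Wk W (mu + k)) 'C(n + k, n).

Definition subalgebra n (A : {mpoly C[n]} -> Prop) : Prop :=
  [/\ A 1, forall f g, A f -> A g -> A (f + g),
      forall (a : C) f, A f -> A (a *: f)
    & forall f g, A f -> A g -> A (f * g)].

(* Main.v *)
(* An operator P of finite order is the same thing as the linear endomorphism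
   w |-> w o P of F, and composition of operators is composition of
   endomorphisms.  Indeed, reading x^i d^k as a commutative monomial, the
   table of the polynomials (d^a o P) / a! is the product exp(x.d) P, which is
   undone by exp(-x.d), and both directions preserve bounds on the order.  If S
   is regular of order mu, the top-degree part of w o S is w_top o sigma(S), so
   w |-> w o S is injective and raises degrees by exactly mu.  Since W A is
   contained in W = F o S, multiplication by f pulls back along S to an
   endomorphism of F raising degrees by exactly deg f; the operator L_S(f) is
   the one representing it, and all the claims are statements about
   endomorphisms, checked after composing with the injective S. *)

Require Import Defs.
From HB Require Import structures.
From mathcomp Require Import all_boot all_algebra.
From mathcomp Require Import mpoly.
From mathcomp Require Import zify ring.
From Stdlib Require Import FunctionalExtensionality ClassicalEpsilon.
Set Implicit Arguments.
Unset Strict Implicit.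
Unset Printing Implicit Defensive.
Import GRing.Theory Num.Theory.
Local Open Scope ring_scope.

(** * Reindexing of sums over bounded multi-indices *)

(** Both sums run, without repetition, over the same values in [T] once zero terms are discarded.
    Matching indices are thus required only on the supports, which is what allows index types with
    different bounds. *)
Lemma eq_big_supp (V : nmodType) (T : eqType) (I J : finType)
    (P : pred I) (Q : pred J) (f : I -> T) (g : J -> T) (F : T -> V) :
  {in P &, injective f} -> {in Q &, injective g} ->
  (forall i, P i -> F (f i) != 0 -> exists2 j, Q j & g j = f i) ->
  (forall j, Q j -> F (g j) != 0 -> exists2 i, P i & f i = g j) ->
  \sum_(i | P i) F (f i) = \sum_(j | Q j) F (g j).
Proof.
have supp_map (K : finType) (p : pred K) (h : K -> T) :
  \sum_(k | p k) F (h k) =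
  \sum_(y <- [seq h k | k <- index_enum K & p k && (F (h k) != 0)]) F y.
  rewrite big_map big_filter big_mkcondr /=; apply: eq_bigr => k _.
  by case: eqP => [->|].
move=> injf injg fg gf; rewrite !supp_map; apply: perm_big; apply: uniq_perm.
- rewrite map_inj_in_uniq ?filter_uniq ?index_enum_uniq // => i1 i2.
  rewrite !mem_filter => /andP[/andP[p1 _] _] /andP[/andP[p2 _] _].
  exact: injf.
- rewrite map_inj_in_uniq ?filter_uniq ?index_enum_uniq // => i1 i2.
  rewrite !mem_filter => /andP[/andP[p1 _] _] /andP[/andP[p2 _] _].
  exact: injg.
move=> y; apply/mapP/mapP => -[k]; rewrite mem_filter => /andP[/andP[pk Fk] _] ->.
- have [j qj gj] := fg _ pk Fk; exists j => //.
  by rewrite mem_filter qj gj Fk mem_index_enum.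
- have [j qj gj] := gf _ pk Fk; exists j => //.
  by rewrite mem_filter qj gj Fk mem_index_enum.
Qed.

Lemma lem_mdeg n (d a : 'X_{1..n}) : (d <= a)%MM -> (mdeg d <= mdeg a)%N.
Proof. by move=> /submK <-; rewrite mdegD leq_addl. Qed.

Lemma mdeg_subm n (d a : 'X_{1..n}) : (d <= a)%MM ->
  (mdeg a = mdeg d + mdeg (a - d)%MM)%N.
Proof. by move=> /submK {1}<-; rewrite mdegD addnC. Qed.

(** Distributivity: choosing one summand i <= c_t in each coordinate t is the same as choosing a
    multi-index below c. *)
Lemma prod_sum_mnm (R : comNzRingType) n (c : 'X_{1..n}) N (F : 'I_n -> nat -> R) :
  (mdeg c < N)%N ->
  \sum_(e : 'X_{1..n < N} | (val e <= c)%MM) \prod_t F t (val e t) =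
  \prod_t \sum_(i < (c t).+1) F t i.
Proof.
case: N => // N ltcN.
have ltc t : (c t < N.+1)%N.
  apply: leq_ltn_trans ltcN; rewrite mdegE (bigD1 t) //=; exact: leq_addr.
(* The ranges depend on t, so they are widened to one common ordinal type; a choice is then a finite
   function. *)
under [RHS]eq_bigr => t _ do rewrite (big_ord_widen _ _ (ltc t)).
rewrite bigA_distr_big_dep /=.
pose f (g : {ffun 'I_n -> 'I_N.+1}) : 'X_{1..n} := [multinom (g t : nat) | t < n].
transitivity (\sum_(g in family (fun (t : 'I_n) (i : 'I_N.+1) => (i < (c t).+1)%N))
    \prod_t F t (f g t)); last first.
  by apply: eq_bigr => g _; apply: eq_bigr => t _; rewrite mnmE.
apply: (eq_big_supp (F := fun e : 'X_{1..n} => \prod_t F t (e t))).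
- by move=> e1 e2 _ _ /val_inj.
- move=> g1 g2 _ _ /mnmP E; apply/ffunP => t; apply: val_inj.
  by have := E t; rewrite !mnmE.
- move=> e /mnm_lepP ec _; exists [ffun t => inord (val e t)].
    apply/familyP => t; rewrite ffunE /in_mem /= inordK ?ltnS //.
    exact: leq_ltn_trans (ec t) (ltc t).
  apply/mnmP => t; rewrite mnmE ffunE inordK //.
  exact: leq_ltn_trans (ec t) (ltc t).
- move=> g /familyP gc _.
  have le : (f g <= c)%MM by apply/mnm_lepP => t; rewrite mnmE; exact: gc.
  have lt : (mdeg (f g) < N.+1)%N by apply: leq_ltn_trans (lem_mdeg le) _.
  by exists (BMultinom lt).
Qed.

Lemma sumr_neq0P (V : nmodType) (I : finType) (P : pred I) (F : I -> V) :
  \sum_(i | P i) F i != 0 -> exists2 i, P i & F i != 0.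
Proof.
move=> nz; have [i /andP[Pi Fi]|F0] := pickP (fun i => P i && (F i != 0)).
  by exists i.
rewrite big1 ?eqxx // in nz => i Pi.
by have := F0 i; rewrite Pi => /negbFE /eqP.
Qed.

Lemma big_mnm_widen (V : nmodType) n N1 N2 (P : pred 'X_{1..n})
    (F : 'X_{1..n} -> V) :
  (forall d, P d -> F d != 0 -> (mdeg d < N1)%N && (mdeg d < N2)%N) ->
  \sum_(d : 'X_{1..n < N1} | P (val d)) F (val d) =
  \sum_(d : 'X_{1..n < N2} | P (val d)) F (val d).
Proof.
move=> supp; apply: eq_big_supp.
- by move=> e1 e2 _ _ /val_inj.
- by move=> e1 e2 _ _ /val_inj.
- by move=> d Pd /(supp _ Pd) /andP[_ lt]; exists (BMultinom lt).
- by move=> d Pd /(supp _ Pd) /andP[lt _]; exists (BMultinom lt).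
Qed.

(** * Multiplication by exp(s x.d) on coefficient families *)

Section Exponential.
Variables (K : numFieldType) (n : nat).
Implicit Types (P : 'X_{1..n} -> 'X_{1..n} -> K) (a d e m : 'X_{1..n}).

Definition mfact a : K := \prod_t (a t)`!%:R.

Lemma natf_neq0 k : k`!%:R != 0 :> K.
Proof. by rewrite pnatr_eq0 -lt0n fact_gt0. Qed.

Lemma mfact_neq0 a : mfact a != 0.
Proof. by apply/prodf_neq0 => t _; exact: natf_neq0. Qed.

Lemma mfact_Vexp (s : K) a :
  s ^+ mdeg a / mfact a = \prod_t (s ^+ a t / (a t)`!%:R).
Proof. by rewrite big_split /= mdegE expr_sum prodfV. Qed.

(** The degree k coefficient of exp(sX) exp(tX) = exp((s + t)X), that is, the binomial theorem
    divided by k!. *)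
Lemma expfact_binomial (s t : K) k :
  \sum_(i < k.+1) (s ^+ i / i`!%:R) * (t ^+ (k - i) / (k - i)`!%:R) =
  (s + t) ^+ k / k`!%:R.
Proof.
rewrite addrC exprDn mulr_suml; apply: eq_bigr => i _.
have ik : (i <= k)%N by rewrite -ltnS.
have /(congr1 (fun x : nat => x%:R : K)) := bin_fact ik.
rewrite !natrM -mulr_natr => <-.
have := natf_neq0 i; have := natf_neq0 (k - i).
have : 'C(k, i)%:R != 0 :> K by rewrite pnatr_eq0 -lt0n bin_gt0.
by move=> *; field; apply/and3P; split.
Qed.

(** The sum factors over the coordinates by [prod_sum_mnm], and each factor is the one-variable
    identity. *)
Lemma mexpfact_binomial (s t : K) (c : 'X_{1..n}) N : (mdeg c < N)%N ->
  \sum_(d : 'X_{1..n < N} | (val d <= c)%MM)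
     (s ^+ mdeg (val d) / mfact (val d)) *
     (t ^+ mdeg (c - val d)%MM / mfact (c - val d)%MM) =
  (s + t) ^+ mdeg c / mfact c.
Proof.
move=> ltc; rewrite mfact_Vexp.
under [RHS]eq_bigr => i _ do rewrite -expfact_binomial.
rewrite -(prod_sum_mnm (fun i k => s ^+ k / k`!%:R *
  (t ^+ (c i - k) / (c i - k)`!%:R)) ltc).
apply: eq_bigr => d _; rewrite !mfact_Vexp -big_split /=.
by apply: eq_bigr => i _; rewrite mnmBE.
Qed.

(* Multiplication by [exp (s x.d)] when [x^i d^k] is read as a commutative
   monomial. *)
Definition mulexp (s : K) P : 'X_{1..n} -> 'X_{1..n} -> K := fun m a =>
  \sum_(d : 'X_{1..n < (mdeg a).+1} | (val d <= a)%MM && (val d <= m)%MM)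
    s ^+ mdeg (val d) / mfact (val d) * P (m - val d)%MM (a - val d)%MM.

Lemma big_lem_widen N1 N2 a (Q : pred 'X_{1..n}) (F : 'X_{1..n} -> K) :
  (mdeg a < N1)%N -> (mdeg a < N2)%N ->
  \sum_(d : 'X_{1..n < N1} | (val d <= a)%MM && Q (val d)) F (val d) =
  \sum_(d : 'X_{1..n < N2} | (val d <= a)%MM && Q (val d)) F (val d).
Proof.
move=> a1 a2; apply: (big_mnm_widen (P := fun d => (d <= a)%MM && Q d)) => d.
by case/andP => /lem_mdeg da _ _; rewrite !(leq_ltn_trans da).
Qed.

Lemma mulexpE N (s : K) P m a : (mdeg a < N)%N ->
  mulexp s P m a =
  \sum_(d : 'X_{1..n < N} | (val d <= a)%MM && (val d <= m)%MM)
    s ^+ mdeg (val d) / mfact (val d) * P (m - val d)%MM (a - val d)%MM.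
Proof.
by move=> ltaN; apply: (@big_lem_widen _ N a (fun d => (d <= m)%MM)
  (fun d => s ^+ mdeg d / mfact d * P (m - d)%MM (a - d)%MM)).
Qed.

(** The exponential law; together with [mulexp0] it makes [mulexp 1] and [mulexp (-1)] mutually
    inverse. *)
Lemma mulexpD (s t : K) P : mulexp s (mulexp t P) = mulexp (s + t) P.
Proof.
apply: functional_extensionality => m; apply: functional_extensionality => a.
set N := (mdeg a).+1.
(* Here c is the total shift and d the part of it due to the outer exponential, so the inner one
   contributes c - d. *)
pose F (cd : 'X_{1..n} * 'X_{1..n}) := let: (c, d) := cd in
  (s ^+ mdeg d / mfact d) * (t ^+ mdeg (c - d)%MM / mfact (c - d)%MM) *
  P (m - c)%MM (a - c)%MM.
transitivity (\sum_(c : 'X_{1..n < N} | (val c <= a)%MM && (val c <= m)%MM)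
  \sum_(d : 'X_{1..n < N} | (val d <= val c)%MM) F (val c, val d)); last first.
  apply: eq_bigr => c /andP[ca cm].
  rewrite -mulr_suml mexpfact_binomial //.
  exact: leq_ltn_trans (lem_mdeg ca) _.
rewrite pair_big_dep /=.
transitivity (\sum_(d : 'X_{1..n < N} | (val d <= a)%MM && (val d <= m)%MM)
  \sum_(d' : 'X_{1..n < N} | (val d' <= a - val d)%MM && (val d' <= m - val d)%MM)
   F ((val d + val d')%MM, val d)).
  apply: eq_bigr => d _; rewrite (@mulexpE N) ?ltnS; last exact: mdegB.
  rewrite mulr_sumr.
  apply: eq_bigr => d' _; rewrite /F addmC addmK addmC !submDA mulrA.
  by [].
rewrite pair_big_dep /=.
apply: (eq_big_supp (F := F)
  (f := fun i : 'X_{1..n < N} * 'X_{1..n < N} => ((val i.1 + val i.2)%MM, val i.1))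
  (g := fun i : 'X_{1..n < N} * 'X_{1..n < N} => (val i.1, val i.2))).
- move=> [d1 d1'] [d2 d2'] _ _ /= E.
  have /val_inj e1 := congr1 snd E; have /eqP := congr1 fst E.
  by rewrite /= e1 eqm_add2l => /eqP /val_inj ->.
- by move=> [d1 d1'] [d2 d2'] _ _ /= [] /val_inj <- /val_inj <-.
- move=> [d d'] /= /andP[/andP[da dm] /andP[d'a d'm]] _.
  have le x : (d <= x)%MM -> (d' <= x - d)%MM -> (d + d' <= x)%MM.
    move=> /mnm_lepP dx /mnm_lepP d'x; apply/mnm_lepP => i.
    by have := dx i; have := d'x i; rewrite ?mnmE; lia.
  have lt : (mdeg (val d + val d')%MM < N)%N by rewrite ltnS lem_mdeg // le.
  exists (BMultinom lt, d) => //=.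
  by rewrite !le //= lem_addr.
- move=> [c d] /= /andP[/andP[ca cm] dc] _.
  have lt : (mdeg (val c - val d)%MM < N)%N.
    by apply: leq_ltn_trans (mdegB _ _) _; apply: leq_ltn_trans (lem_mdeg ca) _.
  have le x : (c <= x)%MM -> (d <= x)%MM && (c - d <= x - d)%MM.
    move=> /mnm_lepP cx; move/mnm_lepP: dc => dc.
    by apply/andP; split; apply/mnm_lepP => i;
      have := cx i; have := dc i; rewrite ?mnmE; lia.
  exists (d, BMultinom lt) => /=; last by rewrite addmC submK.
  by have /andP[-> ->] := le _ ca; have /andP[-> ->] := le _ cm.
Qed.

Lemma mulexp0 P : mulexp 0 P = P.
Proof.
apply: functional_extensionality => m; apply: functional_extensionality => a.
rewrite /mulexp (bigD1 (BMultinom (bm0_proof n (mdeg a)))) /=; last first.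
  by apply/andP; split; apply/mnm_lepP => i; rewrite mnm0E.
rewrite big1 ?addr0 => [|d /andP[_]].
  by rewrite mdeg0 expr0 /mfact big1 ?divr1 ?mul1r ?subm0 // => i _; rewrite mnm0E.
rewrite bmeqP /= -mdeg_eq0 => nz.
by rewrite expr0n (negPf nz) !mul0r.
Qed.

End Exponential.

(** A bound only concerns |k| - |i|, which is unchanged when both exponents are shifted by the same
    d. *)
Lemma mulexp_bound n s (P : sop n) b : has_bound P b -> has_bound (mulexp s P) b.
Proof.
move=> bP m a /sumr_neq0P[d /andP[da dm]].
rewrite mulf_eq0 => /norP[_ /bP].
have := mdeg_subm da; have := mdeg_subm dm; lia.
Qed.

(** * Operators encoded by their action on monomials *)

(** For d <= a this is a!/d!, the coefficient of 'X_[d] in 'X_[a] o x^(a - d). *)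
Definition mffact n (a d : 'X_{1..n}) : nat :=
  (\prod_(t < n) (a t) ^_ (a t - d t))%N.

Lemma mffactE n (a d : 'X_{1..n}) : (d <= a)%MM ->
  (mffact a d)%:R = mfact C a / mfact C d.
Proof.
move=> /mnm_lepP da; rewrite /mfact -prodf_div /mffact natr_prod.
apply: eq_bigr => t _; rewrite -(ffact_fact (leq_subr (d t) (a t))) subKn //.
by rewrite natrM mulfK // pnatr_eq0 -lt0n fact_gt0.
Qed.

(* The coefficient of [d^m] in [d^a o P]. *)
Definition dact n (P : sop n) (a m : 'X_{1..n}) : C :=
  \sum_(d : 'X_{1..n < (mdeg a).+1} | (val d <= a)%MM && (val d <= m)%MM)
    P (m - val d)%MM (a - val d)%MM * (mffact a (val d))%:R.

Lemma dactE n (P : sop n) a m : dact P a m = mfact C a * mulexp 1 P m a.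
Proof.
rewrite mulr_sumr; apply: eq_bigr => d /andP[da _].
by rewrite mffactE // expr1n mulrC mulrA mul1r.
Qed.

Lemma dact_widen n N (P : sop n) a m : (mdeg a < N)%N -> dact P a m =
  \sum_(d : 'X_{1..n < N} | (val d <= a)%MM && (val d <= m)%MM)
    P (m - val d)%MM (a - val d)%MM * (mffact a (val d))%:R.
Proof.
by by move=> ltaN; apply: (@big_lem_widen _ n _ N a (fun d => (d <= m)%MM)
  (fun d => P (m - d)%MM (a - d)%MM * (mffact a d)%:R)).
Qed.

(** Up to the nonzero factor a!, the table is [mulexp 1 P], from which [mulexp (-1)] recovers P. *)
Lemma dact_inj n (P Q : sop n) :
  (forall a m, dact P a m = dact Q a m) -> P = Q.
Proof.
move=> eqPQ; rewrite -[P]mulexp0 -[Q]mulexp0 -(addNr 1) -!mulexpD.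
congr mulexp; apply: functional_extensionality => m.
apply: functional_extensionality => a.
by apply: (mulfI (mfact_neq0 C a)); rewrite -!dactE.
Qed.

(** Each coefficient of [mulexp (-1)] is a finite sum, so the inverse exponential can be applied to
    any table at all; finiteness of the order is handled separately by [has_boundP]. *)
Lemma dact_surj n (G : 'X_{1..n} -> 'X_{1..n} -> C) :
  exists P : sop n, forall a m, dact P a m = G a m.
Proof.
exists (mulexp (-1) (fun m a => G a m / mfact C a)) => a m.
by rewrite dactE mulexpD addrN mulexp0 mulrC divfK ?mfact_neq0.
Qed.

Lemma has_boundP n (P : sop n) b : has_bound P b <->
  (forall a m, dact P a m != 0 -> (mdeg m <= mdeg a + b)%N).
Proof.
split=> [bP a m|bP].
  by rewrite dactE mulf_eq0 => /norP[_ /(mulexp_bound bP)].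
rewrite -[P]mulexp0 -(addNr 1) -mulexpD; apply: mulexp_bound => m a.
by move=> nz; apply: bP; rewrite dactE mulf_neq0 ?mfact_neq0.
Qed.

(** * The product and the right action in terms of [dact] *)

Lemma bnd_spec n (P : sop n) : inS P -> has_bound P (bnd P).
Proof.
rewrite /bnd; case: excluded_middle_informative => // iP _.
by case: constructive_indefinite_description.
Qed.

(** A nonzero term has |j| + |d| <= |p| + [bnd P] <= |i| + [bnd P], so all three sums may share any
    range large enough to contain these indices. *)
Lemma mulS_widen n N (P Q : sop n) m i : inS P ->
  (mdeg i + bnd P < N)%N -> (mdeg m < N)%N -> mulS P Q m i =
  \sum_(j : 'X_{1..n < N})
   \sum_(d : 'X_{1..n < N} | (val d <= m)%MM)
    \sum_(p : 'X_{1..n < N} | (val p <= i)%MM)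
      P (val j + val d)%MM (val p) * Q (m - val d)%MM (i - val p + val j)%MM
        * (leib (val j) (val d) (i - val p + val j)%MM)%:R.
Proof.
move=> /bnd_spec bP iN mN.
pose F j d p := P (j + d)%MM p * Q (m - d)%MM (i - p + j)%MM
        * (leib j d (i - p + j)%MM)%:R.
have widen_le N1 N2 (x : 'X_{1..n}) G :
  (mdeg x < N1)%N -> (mdeg x < N2)%N ->
  \sum_(d : 'X_{1..n < N1} | (val d <= x)%MM) G (val d) =
  \sum_(d : 'X_{1..n < N2} | (val d <= x)%MM) G (val d) :> C.
  move=> x1 x2; apply: (big_mnm_widen (P := fun d => (d <= x)%MM)) => d.
  by move=> /lem_mdeg dx _; rewrite !(leq_ltn_trans dx).
have iN' : (mdeg i < N)%N by apply: leq_ltn_trans iN; exact: leq_addr.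
transitivity (\sum_(j : 'X_{1..n < (mdeg i + bnd P).+1})
   \sum_(d : 'X_{1..n < N} | (val d <= m)%MM)
    \sum_(p : 'X_{1..n < N} | (val p <= i)%MM) F (val j) (val d) (val p)).
  apply: eq_bigr => j _.
  rewrite (widen_le _ N m (fun d =>
    \sum_(p : 'X_{1..n < (mdeg i).+1} | (val p <= i)%MM) F (val j) d (val p))) //.
  by apply: eq_bigr => d _; exact: (widen_le _ N i (F (val j) (val d))).
apply: (big_mnm_widen (P := xpredT) (F := fun j =>
  \sum_(d : 'X_{1..n < N} | (val d <= m)%MM)
    \sum_(p : 'X_{1..n < N} | (val p <= i)%MM) F j (val d) (val p))) => j _.
move=> /sumr_neq0P[d dm /sumr_neq0P[p pi]].
rewrite /F !mulf_eq0 !negb_or => /andP[/andP[/bP + _] _].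
rewrite mdegD => bj; have := lem_mdeg pi; lia.
Qed.

Lemma emb_bound n (w : {mpoly C[n]}) : has_bound (emb w) (msize w).
Proof.
move=> k i; rewrite /emb; case: (i =P 0%MM) => [->|_]; last by rewrite eqxx.
by rewrite mdeg0 add0n -mcoeff_msupp => /msize_mdeg_lt /ltnW.
Qed.

(** The Leibniz term in which x^(a - d) is differentiated down to a constant: binom(a, d) (a - d)! =
    a!/d!. *)
Lemma leib_diag n (a d : 'X_{1..n}) : (d <= a)%MM ->
  leib (a - d) d (a - d) = mffact a d.
Proof.
move=> /mnm_lepP da; apply: eq_bigr => t _.
by rewrite mnmBE subnK // ffactnn bin_ffact.
Qed.

Lemma mulS_emb0 n N (w : {mpoly C[n]}) (P : sop n) m : (msize w <= N)%N ->
  mulS (emb w) P m 0%MM = \sum_(a : 'X_{1..n < N}) w@_(val a) * dact P (val a) m.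
Proof.
move=> wN; have wS : inS (emb w) by exists (msize w); exact: emb_bound.
pose M := (N + bnd (emb w) + mdeg m).+1.
pose F (ad : 'X_{1..n} * 'X_{1..n}) := w@_ad.1 *
  (P (m - ad.2)%MM (ad.1 - ad.2)%MM * (mffact ad.1 ad.2)%:R).
have wM a : w@_a != 0 -> (mdeg a < N)%N.
  by rewrite -mcoeff_msupp => /msize_mdeg_lt /leq_trans; apply.
transitivity (\sum_(a : 'X_{1..n < N}) \sum_(d : 'X_{1..n < N} |
    (val d <= val a)%MM && (val d <= m)%MM) F (val a, val d)); last first.
  by apply: eq_bigr => a _; rewrite (dact_widen _ _ (bmdeg a)) mulr_sumr.
rewrite (@mulS_widen _ M) //; [|rewrite mdeg0 /M; lia|rewrite /M; lia].
rewrite pair_big_dep pair_big_dep [RHS]pair_big_dep /=.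
(* A triple (j, d, p) has p = 0; the monomial of w it comes from is a = j + d, of which d survives
   the differentiation. *)
pose h (i : 'X_{1..n < M} * 'X_{1..n < M} * 'X_{1..n < M}) :=
  ((val i.1.1 + val i.1.2)%MM, val i.1.2).
have le0 (p : 'X_{1..n}) : (p <= 0)%MM -> p = 0%MM.
  by move=> /lem_mdeg; rewrite mdeg0 leqn0 mdeg_eq0 => /eqP.
transitivity (\sum_(i : 'X_{1..n < M} * 'X_{1..n < M} * 'X_{1..n < M} |
   (val i.1.2 <= m)%MM && (val i.2 <= 0)%MM) F (h i)).
  apply: eq_bigr => -[[j d] p] /= /andP[dm /le0 ->].
  by rewrite /F /h /emb /= eqxx subm0 add0m -leib_diag ?lem_addl // addmK mulrA.
apply: (eq_big_supp (F := F) (f := h)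
  (g := fun i : 'X_{1..n < N} * 'X_{1..n < N} => (val i.1, val i.2))).
- move=> [[j1 d1] p1] [[j2 d2] p2] /andP[_ /le0 p10] /andP[_ /le0 p20] E.
  have /val_inj /= e1 := congr1 snd E; have /eqP := congr1 fst E.
  rewrite /= e1 eqm_add2r => /eqP /val_inj ->.
  by have -> : p1 = p2 by apply: val_inj; rewrite p10 p20.
- by move=> [d1 d1'] [d2 d2'] _ _ /= [] /val_inj <- /val_inj <-.
- move=> [[j d] p] /= /andP[dm _]; rewrite /F mulf_eq0 negb_or => /andP[/wM jd _].
  have dN : (mdeg (val d) < N)%N by apply: leq_ltn_trans jd; rewrite lem_mdeg ?lem_addl.
  by exists (BMultinom jd, BMultinom dN) => //=; rewrite lem_addl.
- move=> [a d] /= /andP[da dm] _.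
  have ltM (x : 'X_{1..n}) : (x <= val a)%MM -> (mdeg x < M)%N.
    by move=> /lem_mdeg; have : (mdeg (val a) < N)%N := bmdeg a; rewrite /M; lia.
  have M0 : (mdeg (0 : 'X_{1..n})%MM < M)%N by rewrite mdeg0.
  exists (BMultinom (ltM _ (lem_subr (val a) (val d))),
          BMultinom (ltM _ da), BMultinom M0) => /=.
    by rewrite dm lepm_refl.
  by rewrite /h /= submK.
Qed.

(** The truncation in [actF] loses nothing: beyond it the bound on P makes every entry [dact P a m]
    with |a| < [msize w] vanish. *)
Lemma mcoeff_actF n N (w : {mpoly C[n]}) (P : sop n) m : inS P -> (msize w <= N)%N ->
  (actF w P)@_m = \sum_(a : 'X_{1..n < N}) w@_(val a) * dact P (val a) m.
Proof.
move=> /bnd_spec bP wN; rewrite -mulS_emb0 //.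
have [ltm|gem] := ltnP (mdeg m) (msize w + bnd P).+1.
  by rewrite (mcoeff_mpoly (fun m => mulS (emb w) P m 0%MM)).
rewrite (mulS_emb0 _ _ (leqnn _)) big1; last first.
  move=> a _; have [->|/eqP nz] := dact P (val a) m =P 0; first by rewrite mulr0.
  have := (has_boundP _ _).1 bP _ _ nz.
  have : (mdeg (val a) < msize w)%N := bmdeg a; lia.
rewrite /actF raddf_sum big1 // => k _.
rewrite /= mcoeffZ mcoeffX; case: eqP => [km|_]; last by rewrite mulr0.
have : (mdeg (val k) < (msize w + bnd P).+1)%N := bmdeg k.
by rewrite /= km ltnNge gem.
Qed.

Lemma actF_linear n (P : sop n) : inS P -> linear (fun w => actF w P).
Proof.
move=> bP c u v; apply/mpolyP => m.
pose N := (msize u + msize v + msize (c *: u + v))%N.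
rewrite mcoeffD mcoeffZ !(@mcoeff_actF _ N) //; try by rewrite /N; lia.
rewrite mulr_sumr -big_split; apply: eq_bigr => a _ /=.
by rewrite mcoeffD mcoeffZ mulrDl mulrA.
Qed.

Lemma mcoeff_actX n (P : sop n) a m : inS P -> (actF 'X_[a] P)@_m = dact P a m.
Proof.
move=> bP; have aN : (mdeg a < msize ('X_[C, a] : {mpoly C[n]}))%N by rewrite msizeX.
rewrite (mcoeff_actF _ bP (leqnn _)) (bigD1 (BMultinom aN)) //= mcoeffX eqxx mul1r.
rewrite (big1 (R := C)) ?addr0 // => b; rewrite bmeqP /= eq_sym => ab.
by rewrite mcoeffX (negPf ab) mul0r.
Qed.

(** Since [emb f] has no positive power of x, the sum defining [dact] keeps only the term d = a. *)
Lemma actF_emb n (u f : {mpoly C[n]}) : actF u (emb f) = u * f.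
Proof.
have fS : inS (emb f) by exists (msize f); exact: emb_bound.
apply/mpolyP => m.
pose N := (msize u + mdeg m).+1.
rewrite (@mcoeff_actF _ N) //; last by rewrite /N; lia.
rewrite (@mcoeff_poly_mul_lin _ _ _ _ _ N); last by rewrite /N; lia.
rewrite [RHS]big_mkcond /=; apply: eq_bigr => a _.
rewrite (@dact_widen _ N) ?bmdeg //.
have le_eq (d : 'X_{1..n}) : (d <= val a)%MM -> (val a - d)%MM = 0%MM -> val a = d.
  by move=> da da0; rewrite -(submK da) da0 add0m.
rewrite /emb; case: ifP => am; last first.
  rewrite big1 ?mulr0 // => d /andP[da dm].
  case: (_ =P 0%MM) => [/(le_eq _ da) da0|]; last by rewrite mul0r.
  by rewrite da0 dm in am.
rewrite (bigD1 a) ?lepm_refl ?am //=.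
rewrite (big1 (R := C)) ?addr0 => [|d /andP[/andP[da _] nda]].
  have -> : (val a - val a)%MM = 0%MM by apply/mnmP => t; rewrite mnmBE mnm0E subnn.
  by rewrite eqxx mffactE ?lepm_refl // divff ?mulr1 // mfact_neq0.
case: (_ =P 0%MM) => [/(le_eq _ da) da0|]; last by rewrite mul0r.
by rewrite bmeqP da0 eqxx in nda.
Qed.

(** * The product of operators is composition of endomorphisms *)

(** One coordinate of the coefficient in [dact_mulS], rewritten so that, for fixed b = d1 + j + d
    and d2 = d + e, only the two binomials depend on e. *)
Lemma leib_vandermonde_term (a d d1 e j : nat) : (e <= d1 <= a)%N ->
  (a ^_ (a - e) * ('C(j + d, j) * (d1 - e + j) ^_ j) =
   a ^_ (a - d1) * (d1 - e + j)`! * ('C(d1, e) * 'C(j + d, d)))%N.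
Proof.
(* Multiplying by e! turns the falling factorials into factorials without any division. *)
move=> /andP[ed1 d1a]; apply/eqP; rewrite -(eqn_pmul2r (fact_gt0 e)); apply/eqP.
have -> : 'C(j + d, d) = 'C(j + d, j) by rewrite -bin_sub ?leq_addl // addnK.
have h1 : (a ^_ (a - e) * e`! = a ^_ (a - d1) * d1`!)%N.
  have := ffact_fact (leq_subr e a); rewrite subKn ?(leq_trans ed1) // => ->.
  by have := ffact_fact (leq_subr d1 a); rewrite subKn.
have h2 := bin_fact ed1.
have h3 : ((d1 - e + j) ^_ j * (d1 - e)`! = (d1 - e + j)`!)%N.
  by rewrite -[in RHS](ffact_fact (leq_addl (d1 - e) j)) addnK.
rewrite mulnAC h1 -h2 -h3; ring.
Qed.

(** Vandermonde in each coordinate gives binom(b, d2), and (b - d2)! binom(b, d2) = b!/d2!. *)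
Lemma mffact_vandermonde (K : numFieldType) n N (b d1 d2 : 'X_{1..n}) :
  (mdeg d2 < N)%N -> (d1 <= b)%MM -> (d2 <= b)%MM ->
  \sum_(e : 'X_{1..n < N} | (val e <= d2)%MM)
     ((\prod_(t < n) (b t - d2 t)`!) *
      \prod_(t < n) ('C(d1 t, val e t) * 'C(b t - d1 t, d2 t - val e t)))%:R =
  (mffact b d2)%:R :> K.
Proof.
move=> ltN /mnm_lepP d1b /mnm_lepP d2b.
set A := (\prod_(t < n) (b t - d2 t)`!)%N.
pose G (t : 'I_n) i : K := ('C(d1 t, i) * 'C(b t - d1 t, d2 t - i))%:R.
transitivity (A%:R * \sum_(e : 'X_{1..n < N} | (val e <= d2)%MM) \prod_t G t (val e t)).
  by rewrite mulr_sumr; apply: eq_bigr => e _; rewrite natrM !natr_prod.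
rewrite (prod_sum_mnm G ltN) /A /mffact !natr_prod -big_split /=.
apply: eq_bigr => t _.
rewrite -natr_sum binomial.Vandermonde subnKC // -natrM.
by rewrite -[in RHS]bin_ffact bin_sub // mulnC.
Qed.

Lemma prodn_neq0P (I : finType) (F : I -> nat) :
  (\prod_t F t)%N != 0%N -> forall t, F t != 0%N.
Proof.
by move=> nz t; apply: contra nz => /eqP F0; rewrite (bigD1 t) //= F0.
Qed.

(* Substituting [p = a - d1], [j + d = b - d1] and [d + e = d2] in the
   coefficient of [d^m] in [d^a o (P Q)] turns the sum over [e] into a
   Vandermonde convolution. *)
Lemma dact_mulS n N (P Q : sop n) a m : inS P -> (mdeg a + bnd P < N)%N ->
  dact (mulS P Q) a m = \sum_(b : 'X_{1..n < N}) dact P a (val b) * dact Q (val b) m.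
Proof.
move=> iP aN; have bP := bnd_spec iP.
set M := (N + mdeg m).+1.
have aM : (mdeg a < M)%N by rewrite /M; lia.
pose F (x : 'X_{1..n} * 'X_{1..n} * 'X_{1..n} * 'X_{1..n}) :=
  let: (b, d1, d2, e) := x in
  P (b - d1)%MM (a - d1)%MM * (mffact a d1)%:R * (Q (m - d2)%MM (b - d2)%MM *
    ((\prod_(t < n) (b t - d2 t)`!) *
      \prod_(t < n) ('C(d1 t, e t) * 'C(b t - d1 t, d2 t - e t)))%:R).
pose hl (x : 'X_{1..n < M} * 'X_{1..n < M} * 'X_{1..n < M} * 'X_{1..n < M}) :=
  let: (e, j, d, p) := x in
  ((val j + val d + (a - val p))%MM, (a - val p)%MM, (val d + val e)%MM, val e).
pose hr (x : 'X_{1..n < N} * 'X_{1..n < M} * 'X_{1..n < M} * 'X_{1..n < M}) :=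
  let: (b, d1, d2, e) := x in (val b, val d1, val d2, val e).
(* Right-hand side: d1 and d2 are the indices of the two [dact] factors, and Vandermonde read
   backwards introduces e. *)
transitivity (\sum_(x : 'X_{1..n < N} * 'X_{1..n < M} * 'X_{1..n < M} * 'X_{1..n < M} |
   ((val x.1.1.2 <= a)%MM && (val x.1.1.2 <= val x.1.1.1)%MM) &&
   ((val x.1.2 <= val x.1.1.1)%MM && (val x.1.2 <= m)%MM) &&
   (val x.2 <= val x.1.2)%MM) F (hr x)); last first.
  transitivity (\sum_(b : 'X_{1..n < N})
    \sum_(d1 : 'X_{1..n < M} | (val d1 <= a)%MM && (val d1 <= val b)%MM)
    \sum_(d2 : 'X_{1..n < M} | (val d2 <= val b)%MM && (val d2 <= m)%MM)
    \sum_(e : 'X_{1..n < M} | (val e <= val d2)%MM) F (val b, val d1, val d2, val e)).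
    by rewrite pair_big_dep pair_big_dep pair_big_dep; apply: eq_bigr => -[[[b d1] d2] e].
  apply: eq_bigr => b _; rewrite (dact_widen _ _ aM) (@dact_widen _ M) //; last first.
    by apply: (leq_trans (bmdeg b)); rewrite /M; lia.
  rewrite big_distrlr /=; apply: eq_bigr => d1 /andP[d1a d1b].
  apply: eq_bigr => d2 /andP[d2b d2m].
  by rewrite -(mffact_vandermonde C (bmdeg d2) d1b d2b) !mulr_sumr.
(* Left-hand side: e is the index of the outer [dact], while j, d and p are those of the Leibniz
   product. *)
transitivity (\sum_(x : 'X_{1..n < M} * 'X_{1..n < M} * 'X_{1..n < M} * 'X_{1..n < M} |
   ((val x.1.1.1 <= a)%MM && (val x.1.1.1 <= m)%MM) &&
   (val x.1.2 <= m - val x.1.1.1)%MM && (val x.2 <= a - val x.1.1.1)%MM) F (hl x)).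
  transitivity (\sum_(e : 'X_{1..n < M} | (val e <= a)%MM && (val e <= m)%MM)
    \sum_(j : 'X_{1..n < M})
    \sum_(d : 'X_{1..n < M} | (val d <= m - val e)%MM)
    \sum_(p : 'X_{1..n < M} | (val p <= a - val e)%MM) F (hl (e, j, d, p))); last first.
    rewrite pair_big_dep pair_big_dep pair_big_dep; apply: eq_big => [|[[[e j] d] p]] //=.
    by case=> [[[e j] d] p] /=; rewrite andbT.
  rewrite (dact_widen _ _ aM); apply: eq_bigr => -[e eM] /= /andP[ea em].
  rewrite (@mulS_widen _ M) //; last 2 first.
  - apply: (leq_ltn_trans (leq_add (mdegB _ _) (leqnn _))).
    by rewrite /M; lia.
  - by apply: (leq_ltn_trans (mdegB _ _)); rewrite /M; lia.
  rewrite mulr_suml; apply: eq_bigr => -[j jM] _ /=.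
  rewrite mulr_suml; apply: eq_bigr => -[d dM] /= dm.
  rewrite mulr_suml; apply: eq_bigr => -[p pM] /= pa.
  move/mnm_lepP: ea => ea; move/mnm_lepP: em => em.
  move/mnm_lepP: dm => dm; move/mnm_lepP: pa => pa.
  (* This inequality makes the truncated subtractions below exact. *)
  have pa' t : (p t + e t <= a t)%N.
    by have := pa t; have := ea t; rewrite mnmBE; lia.
  rewrite /F /hl /= addmK.
  have -> : (a - (a - p))%MM = p.
    by apply/mnmP => t; rewrite !mnmBE; have := pa' t; lia.
  have -> : (m - e - d)%MM = (m - (d + e))%MM.
    by rewrite addmC submDA.
  have -> : (j + d + (a - p) - (d + e))%MM =
      (a - e - p + j)%MM.
    by apply/mnmP => t; rewrite !(mnmBE, mnmDE); have := pa' t; lia.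
  have -> : ((mffact a e)%:R = (\prod_(t < n) (a t) ^_ (a t - e t))%N%:R :> C)%R by [].
  rewrite -[RHS]mulrACA -[LHS]mulrA -!natrM.
  do 2!f_equal.
  rewrite /leib /mffact -!big_split /=; apply: eq_bigr => t _.
  rewrite !(mnmBE, mnmDE) mulnC.
  have pt := pa' t.
  have -> : (a t - e t - p t + j t = a t - p t - e t + j t)%N by lia.
  have -> : (j t + d t + (a t - p t) - (d t + e t) =
     a t - p t - e t + j t)%N by lia.
  rewrite leib_vandermonde_term; last by lia.
  by rewrite !addnK !mulnA.
apply: (eq_big_supp (F := F) (f := hl) (g := hr)).
- move=> [[[e1 j1] d1] [p1 p1M]] [[[e2 j2] d2] [p2 p2M]].
  move=> /andP[_ /= pa1] /andP[_ /= pa2] E.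
  have /val_inj ee := congr1 snd E; have := congr1 (fun x => x.1.2) E.
  move=> /= /eqP; rewrite ee eqm_add2r => /eqP /val_inj dd.
  have := congr1 (fun x => x.1.1.2) E => /= pp.
  have {}pp : p1 = p2.
    apply/mnmP => t; move/mnmP/(_ t): pp; rewrite !mnmBE.
    move/mnm_lepP/(_ t): pa1; move/mnm_lepP/(_ t): pa2; rewrite !mnmBE; lia.
  have := congr1 (fun x => x.1.1.1) E => /= /eqP.
  subst p2; rewrite dd !eqm_add2r => /eqP /val_inj ->; congr (_, _).
  exact: val_inj.
- move=> [[[b1 c1] d1] e1] [[[b2 c2] d2] e2] _ _ /= [].
  by do 4!move=> /val_inj <-.
- move=> [[[[e eM] [j jM]] [d dM]] [p pM]] /=.
  move=> /andP[/andP[/andP[/mnm_lepP ea /mnm_lepP em] /mnm_lepP dm] /mnm_lepP pa].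
  rewrite !mulf_eq0 !negb_or addmK => /andP[/andP[/bP + _] _].
  have pa' t : (p t + e t <= a t)%N.
    by have := pa t; have := ea t; rewrite mnmBE; lia.
  have -> : (a - (a - p))%MM = p.
    by apply/mnmP => t; rewrite !mnmBE; have := pa' t; lia.
  move=> jd.
  have ap : (p <= a)%MM by apply/mnm_lepP => t; have := pa' t; lia.
  (* The bound on P gives |j + d| <= |p| + [bnd P], hence |b| <= |a| + [bnd P] < N. *)
  have bN : (mdeg (j + d + (a - p))%MM < N)%N.
    by rewrite mdegD; have := mdeg_subm ap; lia.
  have d1M : (mdeg (a - p)%MM < M)%N by apply: leq_ltn_trans (mdegB _ _) aM.
  have d2m : (d + e <= m)%MM.
    by apply/mnm_lepP => t; have := dm t; have := em t; rewrite mnmBE mnmDE; lia.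
  have d2M : (mdeg (d + e)%MM < M)%N by have := lem_mdeg d2m; rewrite /M; lia.
  exists (BMultinom bN, BMultinom d1M, BMultinom d2M, BMultinom eM) => //=.
  rewrite lem_subr lem_addl d2m lem_addl !andbT /=.
  by apply/mnm_lepP => t; rewrite !mnmDE mnmBE; have := pa' t; lia.
- move=> [[[[b bN] [d1 d1M]] [d2 d2M]] [e eM]] /=.
  move=> /andP[/andP[/andP[/mnm_lepP d1a /mnm_lepP d1b]
    /andP[/mnm_lepP d2b /mnm_lepP d2m]] /mnm_lepP ed2].
  rewrite !mulf_eq0 !negb_or => /andP[_ /andP[_]].
  rewrite pnatr_eq0 muln_eq0 negb_or => /andP[_ /prodn_neq0P nz].
  (* Nonvanishing of the binomials is what makes the inverse substitution j = b - d1 - (d2 - e)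
     legitimate. *)
  have {nz} nz t : (e t <= d1 t)%N /\ (d2 t - e t <= b t - d1 t)%N.
    by have := nz t; rewrite muln_eq0 negb_or -!lt0n !bin_gt0 => /andP[].
  have le (x : 'X_{1..n}) y : (x <= y)%MM -> (mdeg y < M)%N -> (mdeg x < M)%N.
    by move=> /lem_mdeg; exact: leq_ltn_trans.
  have bM : (mdeg b < M)%N.
    by rewrite /M; lia.
  have jM := le _ _ (lem_subr b (d1 + (d2 - e))%MM) bM.
  have dM := le _ _ (lem_subr d2 e) d2M.
  have pM := le _ _ (lem_subr a d1) aM.
  exists (BMultinom eM, BMultinom jM, BMultinom dM, BMultinom pM) => /=.
    apply/andP; split; [apply/andP; split; [apply/andP; split|]|]; apply/mnm_lepP => t;
    have := nz t; have := d1a t; have := d1b t; have := d2b t; have := d2m t;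
    have := ed2 t; rewrite ?(mnmBE, mnmDE); lia.
  have -> : (a - (a - d1) = d1)%MM.
    by apply/mnmP => t; rewrite !mnmBE; have := d1a t; lia.
  congr (_, _, _, _); apply/mnmP => t;
    have := nz t; have := d1a t; have := d1b t; have := d2b t; have := d2m t;
    have := ed2 t; rewrite ?(mnmBE, mnmDE); lia.
Qed.

(** Associativity of the action on monomials, phrased with [dact] on the right so that it makes
    sense without a bound on the order of the product. *)
Lemma mcoeff_actF_actX n (P Q : sop n) a m : inS P -> inS Q ->
  (actF (actF 'X_[a] P) Q)@_m = dact (mulS P Q) a m.
Proof.
move=> iP iQ; pose N := (msize (actF 'X_[a] P) + mdeg a + bnd P).+1.
rewrite (@dact_mulS _ N) // /N; last by lia.
rewrite (@mcoeff_actF _ N) // /N; last by lia.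
by apply: eq_bigr => b _; rewrite mcoeff_actX.
Qed.

(** * Degrees under the action of a regular operator *)

Lemma msize_le n (R : nzRingType) (p : {mpoly R[n]}) k :
  (forall m, p@_m != 0 -> (mdeg m < k)%N) -> (msize p <= k)%N.
Proof.
move=> pk; rewrite msizeE; apply/bigmax_leqP_seq => m mp _; apply: pk.
by rewrite -mcoeff_msupp.
Qed.

Lemma mcoeff_neq0P n (R : nzRingType) (p : {mpoly R[n]}) :
  p != 0 -> exists m, p@_m != 0.
Proof. by move=> /mlead_supp; rewrite mcoeff_msupp => ?; exists (mlead p). Qed.

Lemma actF0 n (P : sop n) : inS P -> actF 0 P = 0.
Proof.
move=> iP; apply/mpolyP => m.
rewrite (mcoeff_actF _ iP (leqnn _)) mcoeff0 big1 // => a _.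
by rewrite mcoeff0 mul0r.
Qed.

Lemma is_order_bound n (P : sop n) (d : nat) :
  is_order P (Some d%:Z) -> has_bound P d.
Proof. by move=> [_ le] k i /le; lia. Qed.

Lemma is_order_uniq n (P : sop n) (d e : int) :
  is_order P (Some d) -> is_order P (Some e) -> d = e.
Proof.
move=> [[k [i [nz <-]]] led] [[k' [i' [nz' <-]]] lee].
by have := led _ _ nz'; have := lee _ _ nz; lia.
Qed.

Lemma hcomp_bound n (P : sop n) b m : has_bound P b -> has_bound (hcomp P m) b.
Proof.
by move=> bP k i; rewrite /hcomp; case: ifP => _; [exact: bP | rewrite eqxx].
Qed.

(** The indices (m - d, a - d) entering the entry (a, m) all have the same difference |m| - |a|, so
    a homogeneous component selects whole entries of the table. *)
Lemma dact_hcomp n (P : sop n) (mu : nat) a m :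
  dact (hcomp P (- mu%:Z)) a m =
  if (mdeg m == mdeg a + mu)%N then dact P a m else 0.
Proof.
transitivity (\sum_(d : 'X_{1..n < (mdeg a).+1} | (val d <= a)%MM && (val d <= m)%MM)
    if (mdeg m == mdeg a + mu)%N then
      P (m - val d)%MM (a - val d)%MM * (mffact a (val d))%:R else 0); last first.
  by case: ifP => _ //; rewrite big1.
apply: eq_bigr => -[d dM] /= /andP[/mdeg_subm da /mdeg_subm dm].
rewrite /hcomp.
have -> : ((mdeg (a - d)%MM)%:Z - (mdeg (m - d)%MM)%:Z == - mu%:Z) =
  (mdeg m == mdeg a + mu)%N by apply/eqP/eqP; lia.
by case: ifP => // _; rewrite mul0r.
Qed.

(* The top-degree part of [w o P] is [w_top o sigma(P)]. *)
Lemma msize_actF_regular n (P : sop n) (mu : nat) (w : {mpoly C[n]}) :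
  regular P -> is_order P (Some mu%:Z) -> w != 0 ->
  msize (actF w P) = (msize w + mu)%N.
Proof.
move=> [d [Pd inj]] Pmu w0; rewrite (is_order_uniq Pd Pmu) in inj.
have bP := is_order_bound Pmu.
have iP : inS P by exists mu.
have iH : inS (hcomp P (- mu%:Z)) by exists mu; exact: hcomp_bound.
have wsz := mpolySpred mdeg w0; set s := (msize w).-1 in wsz.
(* [wt] is the leading form of [w]; its degree [s] is one less than [msize w]. *)
pose E m : C := if mdeg m == s then w@_m else 0.
pose wt : {mpoly C[n]} := \sum_(m : 'X_{1..n < msize w}) E (val m) *: 'X_[val m].
have wtE m : wt@_m = E m.
  have [ltm|gem] := ltnP (mdeg m) (msize w); first exact: mcoeff_mpoly.
  rewrite /E; case: eqP => [ms|_]; first by rewrite ms wsz ltnn in gem.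
  rewrite raddf_sum big1 // => -[k kw] _ /=.
  rewrite mcoeffZ mcoeffX; case: eqP => [km|_]; last by rewrite mulr0.
  by rewrite km ltnNge gem in kw.
have wtsz : (msize wt <= msize w)%N.
  by apply: msize_le => m; rewrite wtE /E wsz; case: ifP => [/eqP ->|] //; rewrite eqxx.
have wt0 : wt != 0.
  apply: contraNneq (w0) => wt0; rewrite -mleadc_eq0; apply/eqP.
  have := wtE (mlead w); rewrite wt0 mcoeff0 /E.
  by have := mlead_deg w0; rewrite wsz => -[->]; rewrite eqxx.
(* Regularity enters here, through the injectivity of the action of the symbol. *)
have : actF wt (hcomp P (- mu%:Z)) != 0.
  by apply: contraNneq (wt0) => A0; apply/eqP/inj; rewrite A0 actF0.
move=> /mcoeff_neq0P[m]; rewrite (mcoeff_actF _ iH wtsz) => nz.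
have ms : mdeg m = (s + mu)%N.
  move: nz => /sumr_neq0P[a _]; rewrite wtE /E dact_hcomp.
  case: ifP => [/eqP <-|_]; last by rewrite mul0r eqxx.
  by case: ifP => [/eqP -> //|_]; rewrite mulr0 eqxx.
apply/eqP; rewrite eqn_leq; apply/andP; split.
  apply: msize_le => k; rewrite (mcoeff_actF _ iP (leqnn _)).
  move=> /sumr_neq0P[[a aw] _] /=; rewrite mulf_eq0 negb_or => /andP[_].
  by move=> /((has_boundP _ _).1 bP) => /leq_ltn_trans; apply; rewrite ltn_add2r.
(* The monomial m also occurs in w o P: terms with |a| < s reach degree at most |a| + mu < s + mu,
   so m has the same coefficient there as in the image of [wt] under the symbol. *)
rewrite wsz addSn -ms; apply: msize_mdeg_lt.
rewrite mcoeff_msupp (mcoeff_actF _ iP (leqnn _)).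
congr (_ != 0): nz; apply: eq_bigr => -[a aw] _ /=.
rewrite wtE /E dact_hcomp ms eqn_add2r eq_sym; case: eqP => [as_|nas]; first by [].
rewrite mul0r; have [->|/eqP nz] := dact P a m =P 0; first by rewrite mulr0.
have := (has_boundP _ _).1 bP _ _ nz; rewrite ms leq_add2r => sa.
by case: nas; apply/eqP; rewrite eqn_leq sa -ltnS -wsz aw.
Qed.

(** * Solving S f = L S for an operator raising degrees by exactly mu *)

Section Commutant.
Variables (n mu : nat) (S : sop n).
Hypotheses (iS : inS S)
  (szS : forall w : {mpoly C[n]}, w != 0 -> msize (actF w S) = (msize w + mu)%N).
Implicit Types (f g u v w : {mpoly C[n]}) (L P Q : sop n).

Lemma actF_injective : injective (fun w => actF w S).
Proof.
move=> u v /= eq_uv; apply/eqP; rewrite -subr_eq0; apply/negPn/negP => uv.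
have uvS : actF (u - v) S = 0.
  by rewrite addrC -scaleN1r (actF_linear iS) /= eq_uv scaleN1r addNr.
by have := szS uv; rewrite uvS msize0 (mpolySpred mdeg uv).
Qed.

(** Equality in the algebra of operators can be tested on monomials by [dact_inj]; there products
    become compositions and [emb f] becomes multiplication by f. *)
Lemma commutantP L f : inS L ->
  mulS S (emb f) = mulS L S <->
  forall a, actF (actF 'X_[a] L) S = actF 'X_[a] S * f.
Proof.
move=> iL; have iE : inS (emb f) by exists (msize f); exact: emb_bound.
split=> [eqL a|eqL].
  by apply/mpolyP => m; rewrite mcoeff_actF_actX // -eqL -mcoeff_actF_actX // actF_emb.
apply: dact_inj => a m.
by rewrite -!mcoeff_actF_actX // actF_emb eqL.
Qed.

Lemma actF_extend L f : inS L ->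
  (forall a, actF (actF 'X_[a] L) S = actF 'X_[a] S * f) ->
  forall w, actF (actF w L) S = actF w S * f.
Proof.
move=> iL eqL; elim/mpolyind => [|c m p _ _ IH]; first by rewrite !actF0 ?mul0r.
rewrite (actF_linear iL) /= !(actF_linear iS) /= eqL IH.
by rewrite mulrDl scalerAl.
Qed.

Lemma sop_eqP L P : inS L -> inS P ->
  (forall a, actF 'X_[a] L = actF 'X_[a] P) -> L = P.
Proof.
by move=> iL iP eqLP; apply: dact_inj => a m; rewrite -!mcoeff_actX // eqLP.
Qed.

Lemma commutant_uniq L P f : inS L -> inS P ->
  mulS S (emb f) = mulS L S -> mulS S (emb f) = mulS P S -> L = P.
Proof.
move=> iL iP /(commutantP _ iL) eqL /(commutantP _ iP) eqP.
by apply: sop_eqP => // a; apply: actF_injective; rewrite eqL eqP.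
Qed.

(** Preimages under the action of S are chosen one by one; L is the operator sending each monomial
    to its chosen image, given by [dact_surj]. *)
Lemma commutant_exists f :
  (forall w, exists u, actF u S = actF w S * f) ->
  exists L, inS L /\ mulS S (emb f) = mulS L S.
Proof.
move=> ex_u; pose phi w := proj1_sig (constructive_indefinite_description _ (ex_u w)).
have phiE w : actF (phi w) S = actF w S * f.
  by rewrite /phi; case: constructive_indefinite_description.
have [L LE] := dact_surj (fun a m => (phi 'X_[a])@_m).
have iL : inS L.
  (* A crude bound, obtained by cancelling mu between the sizes of 'X_[a] o S and [phi 'X_[a]] o S;
     the exact order comes from [commutant_order]. *)
  exists (msize f).+1; apply/has_boundP => a m; rewrite LE => nz.
  have phi0 : phi 'X_[a] != 0 by apply: contraNneq nz => ->; rewrite mcoeff0.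
  have : (mdeg m < msize (phi 'X_[a]))%N by rewrite msize_mdeg_lt ?mcoeff_msupp.
  have := msizeM_le (actF 'X_[a] S) f; rewrite -phiE szS // szS.
    by rewrite msizeX; lia.
  by rewrite -(msize_poly_eq0 (R := C)) msizeX.
exists L; split => //; apply/(commutantP _ iL) => a; rewrite -phiE; congr actF.
by apply/mpolyP => m; rewrite mcoeff_actX // LE.
Qed.

(** For nonzero f, comparing degrees after applying S shows that 'X_[a] o L has degree exactly |a| +
    deg f; all a together bound the order, and a = 0 attains it. *)
Lemma commutant_order L f : inS L -> mulS S (emb f) = mulS L S ->
  is_order L (degF f).
Proof.
move=> iL /(commutantP _ iL) eqL; rewrite /degF; case: eqP => [f0|/eqP f0].
  have -> : L = (fun _ _ => 0); last by [].
  apply: dact_inj => a m; rewrite -mcoeff_actX //.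
  have -> : actF 'X_[a] L = 0.
    by apply: actF_injective; rewrite eqL f0 mulr0 actF0.
  by rewrite mcoeff0 /dact big1 // => d _; rewrite mul0r.
have X0 a : 'X_[a] != 0 :> {mpoly C[n]}.
  by rewrite -(msize_poly_eq0 (R := C)) msizeX.
have LX0 a : actF 'X_[a] L != 0.
  apply: contraNneq (X0 a) => L0; have /esym/eqP := eqL a.
  rewrite L0 actF0 // mulf_eq0 (negPf f0) orbF -(actF0 iS) => /eqP.
  by move=> /actF_injective ->; rewrite actF0.
have szL a : msize (actF 'X_[a] L) = (mdeg a + msize f)%N.
  have := szS (LX0 a); rewrite eqL msizeM //; last first.
    by rewrite -(actF0 iS) (inj_eq actF_injective).
  by rewrite szS // msizeX !addSn /= addnAC => /eqP; rewrite eqn_add2r => /eqP <-.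
have fS := mpolySpred mdeg f0.
split.
  (* m is the leading monomial of 1 o L; for a = 0 only d = 0 contributes, so its coefficient is the
     coefficient of L at x^0. *)
  have [m mL md] : exists2 m, dact L 0 m != 0 & mdeg m = (msize f).-1.
    exists (mlead (actF 'X_[0] L)).
      by rewrite -mcoeff_actX // mleadc_eq0.
    by have := mlead_deg (LX0 0%MM); rewrite szL mdeg0 fS => -[].
  move: mL => /sumr_neq0P[[d dM] /= /andP[d0 _]].
  have -> : d = 0%MM.
    by apply/eqP; rewrite -mdeg_eq0 -leqn0 -[0%N](@mdeg0 n) lem_mdeg.
  rewrite !subm0 mulf_eq0 negb_or => /andP[nz _].
  by exists m, 0%MM; rewrite mdeg0 md subr0.
have : has_bound L (msize f).-1.
  apply/has_boundP => a m; rewrite -mcoeff_actX // -mcoeff_msupp.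
  by move=> /msize_mdeg_lt; rewrite szL fS; lia.
by move=> bL k i /bL; lia.
Qed.

End Commutant.

(** * Compatibility with the algebra operations, and the theorem *)

Lemma emb1 n : emb 1 = @oneS n.
Proof.
apply: functional_extensionality => k; apply: functional_extensionality => i.
by rewrite /emb /oneS mcoeff1; case: (i == 0%MM); rewrite ?andbT ?andbF.
Qed.

Lemma inS_addS n (P Q : sop n) : inS P -> inS Q -> inS (addS P Q).
Proof.
move=> [b bP] [c cQ]; exists (b + c)%N => k i.
have [P0|/eqP /bP] := P k i =P 0; last by lia.
by rewrite /addS P0 add0r => /cQ; lia.
Qed.

Lemma inS_scaleS n c (P : sop n) : inS P -> inS (scaleS c P).
Proof. by move=> [b bP]; exists b => k i; rewrite mulf_eq0 negb_or => /andP[_ /bP]. Qed.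

Lemma actX_addS n (P Q : sop n) a : inS P -> inS Q ->
  actF 'X_[a] (addS P Q) = actF 'X_[a] P + actF 'X_[a] Q.
Proof.
move=> iP iQ; apply/mpolyP => m; have iPQ := inS_addS iP iQ.
rewrite mcoeffD !mcoeff_actX // /dact -big_split.
by apply: eq_bigr => d _; rewrite /addS mulrDl.
Qed.

Lemma actX_scaleS n c (P : sop n) a : inS P ->
  actF 'X_[a] (scaleS c P) = c *: actF 'X_[a] P.
Proof.
move=> iP; apply/mpolyP => m; have icP := inS_scaleS c iP.
rewrite mcoeffZ !mcoeff_actX // /dact mulr_sumr.
by apply: eq_bigr => d _; rewrite /scaleS mulrA.
Qed.

Theorem theorem5p18 (n mu : nat) (W A : {mpoly C[n]} -> Prop) (S : sop n) :
  (0 < n)%N ->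
  Gr mu W ->
  subalgebra A ->
  (forall u, W u <-> exists w a, [/\ W w, A a & u = w * a]) ->
  Sato mu W S ->
  exists L : {mpoly C[n]} -> sop n,
    [/\ (* (1) *)
        forall f, A f ->
          [/\ inS (L f),
              mulS S (emb f) = mulS (L f) S,
              (forall L', inS L' -> mulS S (emb f) = mulS L' S -> L' = L f)
            & is_order (L f) (degF f)],
        (* (2) C-algebra homomorphism A -> S *)
        [/\ L 1 = @oneS n,
            forall f g, A f -> A g -> L (f + g) = addS (L f) (L g),
            forall (a : C) f, A f -> L (a *: f) = scaleS a (L f)
          & forall f g, A f -> A g -> L (f * g) = mulS (L f) (L g)],
        (* (2) injective on A *)
        (forall f g, A f -> A g -> L f = L g -> f = g)
      & (* (3) *)
        forall f w, A f -> actF (actF w (L f)) S = actF w S * f].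

Proof.
move=> _ _ [A1 AD AZ AM] WA [iS rS oS WS].
have szS (w : {mpoly C[n]}) : w != 0 -> msize (actF w S) = (msize w + mu)%N.
  exact: msize_actF_regular.
have injS := actF_injective iS szS.
pose isL f P := inS P /\ mulS S (emb f) = mulS P S.
(* A total function is chosen; its value is controlled only where [isL f] can be satisfied, in
   particular on A. *)
pose L f := epsilon (inhabits (fun _ _ => 0 : C)) (isL f).
have LP f : A f -> isL f (L f).
  move=> Af; apply: epsilon_spec; apply: (commutant_exists iS szS) => w.
  (* W A is contained in W = F o S, so the product has a preimage under the action of S. *)
  have /WS[u ->] : W (actF w S * f).
    by apply/WA; exists (actF w S), f; split=> //; apply/WS; exists w.
  by exists u.
have LX f : A f -> forall a, actF (actF 'X_[a] (L f)) S = actF 'X_[a] S * f.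
  by move=> Af; have [iL] := LP f Af; move/(commutantP iS _ iL).
have LE f P : A f -> inS P ->
    (forall a, actF (actF 'X_[a] P) S = actF 'X_[a] S * f) -> L f = P.
  move=> Af iP; have [iL eqL] := LP f Af; move/(commutantP iS _ iP).
  exact: (commutant_uniq iS szS).
exists L; split.
- move=> f Af; have [iL eqL] := LP f Af; split=> //.
    by move=> P iP eqP; exact: (commutant_uniq iS szS iP iL eqP eqL).
  exact: (commutant_order iS szS).
- split.
  + have iE : inS (emb (1 : {mpoly C[n]})).
      by exists (msize (1 : {mpoly C[n]})); exact: emb_bound.
    by rewrite -emb1; apply: LE => // a; rewrite actF_emb !mulr1.
  + move=> f g Af Ag; have [[iF _] [iG _]] := (LP f Af, LP g Ag).
    apply: LE; [exact: AD | exact: inS_addS | move=> a].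
    rewrite actX_addS // -[actF _ (L f)]scale1r (actF_linear iS) /=.
    by rewrite !LX // scale1r mulrDr.
  + move=> c f Af; have [iF _] := LP f Af.
    apply: LE; [exact: AZ | exact: inS_scaleS | move=> a].
    rewrite actX_scaleS // -[c *: _]addr0 (actF_linear iS) /= actF0 // addr0.
    by rewrite LX // scalerAr.
  + move=> f g Af Ag; have [[iF _] [iG _]] := (LP f Af, LP g Ag).
    have [iFG _] := LP _ (AM _ _ Af Ag).
    (* The tables are compared directly, since [LE] would ask for a bound on the order of the
       product. *)
    apply: dact_inj => a m; rewrite -mcoeff_actX // -mcoeff_actF_actX //.
    congr (_@_m); apply: injS; rewrite LX; last exact: AM.
    by rewrite (actF_extend iS iG (LX g Ag)) LX // mulrA.
- move=> f g Af Ag eqL; have := LX f Af 0%MM; rewrite eqL LX //.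
  (* Both f and g are recovered by cancelling the nonzero polynomial 1 o S in the domain F. *)
  have X0 : actF 'X_[0] S != 0.
    rewrite -(actF0 iS) (inj_eq injS).
    by rewrite -(msize_poly_eq0 (R := C)) msizeX.
  by move/(mulfI X0).
- move=> f w Af; have [iL _] := LP f Af.
  exact: (actF_extend iS iL (LX f Af)).
Qed.
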